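(* Let $X$, $Y$ be Banach spaces, let $T,S\in B(X,Y)$ and let $T$ be a finite rank operator. Then there is an analytic generalized resolvent for the linear pencil $\lambda\mapsto T-\lambda S$ on a neighborhood of $0$ if and only if there exists a neighborhood $U$ of $0$ such that $$\operatorname{Rank}(T-\lambda S)=\operatorname{Rank} T,\qquad \forall\,\lambda\in U.$$
   Context: All spaces are complex. $B(X,Y)$ is the Banach space of bounded linear operators from $X$ to $Y$; $\operatorname{Rank} A$ is the dimension of the range of $A$. For an open set $U\subset\mathbb{C}$, a function $U\ni\lambda\mapsto G(\lambda)\in B(Y,X)$ is a generalized resolvent on $U$ of the linear pencil $\lambda\mapsto T-\lambda S$ if: (i) $(T-\lambda S)G(\lambda)(T-\lambda S)=T-\lambda S$ for all $\lambda\in U$; (ii) $G(\lambda)(T-\lambda S)G(\lambda)=G(\lambda)$ for all $\lambda\in U$; (iii) $G(\lambda)-G(\mu)=(\lambda-\mu)G(\lambda)SG(\mu)$ for all $\lambda,\mu\in U$. It is an analytic generalized resolvent if moreover $\lambda\mapsto G(\lambda)$ is analytic on $U$. Neighborhoods of $0$ are open subsets of $\mathbb{C}$ containing $0$. *)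

(* Defs.v *)
From HB Require Import structures.
From mathcomp Require Import all_boot all_order all_algebra.
From mathcomp Require Import all_classical all_reals all_analysis.
From mathcomp Require Import complex.

Set Implicit Arguments.
Unset Strict Implicit.
Unset Printing Implicit Defensive.

Import Order.TTheory GRing.Theory Num.Theory.
Import numFieldNormedType.Exports.

Local Open Scope classical_set_scope.
Local Open Scope ring_scope.
Local Open Scope complex_scope.

(* The regular algebra R[i]^o, rather than R[i] itself, carries the norm
   topology of the complex plane in the library. *)
Notation Cplx R := (R[i]^o).

Section Operators.
Variables (R : realType) (E F : normedModType R[i]).
Implicit Types f : E -> F.

Definition bounded_operator f : Prop :=
  linear f /\ exists M : R, forall x, `|f x| <= M%:C * `|x|.

(* `|_| takes its values in R[i]; it is real there, so Re loses nothing.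
   The supremum is the operator norm only when f is bounded. *)
Definition opnorm f : R :=
  sup [set complex.Re `|f x| | x in [set x : E | `|x| <= 1]].

End Operators.

Section Rank.
Variables (R : realType) (E F : normedModType R[i]).

Definition lin_indep (n : nat) (e : 'I_n -> F) : Prop :=
  forall c : 'I_n -> R[i], \sum_i c i *: e i = 0 -> forall i, c i = 0.

Definition lin_span (n : nat) (e : 'I_n -> F) : set F :=
  [set v | exists c : 'I_n -> R[i], v = \sum_i c i *: e i].

Definition has_dim (V : set F) (n : nat) : Prop :=
  exists e : 'I_n -> F, lin_indep e /\ V = lin_span e.

(* For a subspace V, Some n if V has dimension n and None if V has infinite
   dimension. *)
Definition dimension (V : set F) : option nat :=
  xget None [set Some n | n in has_dim V].

Definition Rank (f : E -> F) : option nat := dimension (range f).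

Definition finite_rank (f : E -> F) : Prop := exists n, Rank f = Some n.

End Rank.

Section GeneralizedResolvent.
Variables (R : realType) (X Y : normedModType R[i]).
Implicit Types (T S : X -> Y) (U : set (Cplx R)) (G : Cplx R -> Y -> X).

Definition pencil T S (lambda : R[i]) : X -> Y :=
  fun x => T x - lambda *: S x.

Definition generalized_resolvent T S U G : Prop :=
  [/\ forall lambda, U lambda -> bounded_operator (G lambda),
      forall lambda, U lambda ->
        pencil T S lambda \o G lambda \o pencil T S lambda = pencil T S lambda,
      forall lambda, U lambda ->
        G lambda \o pencil T S lambda \o G lambda = G lambda
    & forall lambda mu, U lambda -> U mu ->
        (fun y => G lambda y - G mu y) =
        (fun y => (lambda - mu) *: G lambda (S (G mu y)))].

(* Around each point of U, G is the sum of a power series with coefficients in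
   B(Y, X), converging in operator norm. *)
Definition analytic_on U G : Prop :=
  forall mu, U mu -> exists (r : R) (A : nat -> Y -> X),
    [/\ 0 < r,
        forall k, bounded_operator (A k)
      & forall lambda, U lambda -> `|lambda - mu| < r%:C ->
          opnorm (fun y =>
            G lambda y - \sum_(k < n) (lambda - mu) ^+ k *: A k y)
            @[n --> \oo] --> (0 : R)].

Definition analytic_generalized_resolvent T S U G : Prop :=
  generalized_resolvent T S U G /\ analytic_on U G.

End GeneralizedResolvent.

Definition open_neighborhood0 (R : realType) (U : set (Cplx R)) : Prop :=
  open U /\ U 0.

(* Main.v *)
(** If G is a generalized resolvent, the resolvent identity makes the range of
    G(l) independent of l, while T - l S and G(l), being generalized inverses of
    each other, have the same rank; so the rank of T - l S is constant.

    Conversely, choose x_1, ..., x_n whose images under T form a basis of the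
    range of T.  By Hahn-Banach, bounded functionals separate points, so some
    tuple psi of n of them makes the matrix of all psi_i(T x_j) invertible.  Put
    L c := sum_j c_j x_j and G_A := L (psi A L)^-1 psi.  Whenever psi A L and
    psi B L are invertible, G_A A G_A = G_A and G_A - G_B = G_A (B - A) G_B; and
    A G_A A = A if moreover A has rank n, because the A x_j then span its range.
    Apply this to A = T - l S, for which psi A L stays invertible near l = 0.
    Analyticity is automatic: iterating the resolvent identity gives
    G(l) - sum_(k < n) (l - m)^k (G(m) S)^k G(m) = (l - m)^n (G(m) S)^n G(l). *)
Require Import Defs.
From HB Require Import structures.
From mathcomp Require Import all_boot all_order all_algebra.
From mathcomp Require Import all_classical all_reals all_analysis.
From mathcomp Require Import complex lra.

Set Implicit Arguments.
Unset Strict Implicit.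
Unset Printing Implicit Defensive.

Import Order.TTheory GRing.Theory Num.Theory.
Import numFieldNormedType.Exports.

Local Open Scope classical_set_scope.
Local Open Scope ring_scope.
Local Open Scope complex_scope.

Lemma Zorn_minimal_below d (T : porderType d) (P : set T) (p : T) : P p ->
    (forall A, A `<=` P -> A !=set0 -> total_on A <=%O ->
      exists2 m, P m & forall x, A x -> (m <= x)%O) ->
  exists q, [/\ P q, (q <= p)%O & forall r, P r -> (r <= q)%O -> r = q].
Proof.
move=> Pp chain_lb; pose D := {q | P q /\ (q <= p)%O}.
pose ge (q r : D) := (sval r <= sval q)%O.
have [||||[q [Pq qp]] qmin] := @Zorn D ge.
- by move=> q; exact: lexx.
- by move=> q r s; rewrite /ge => rq sr; exact: le_trans sr rq.
- by move=> [q hq] [r hr] rq qr; apply/eq_exist/le_anti/andP; split.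
- move=> A Atot; have [A0|/set0P A0] := eqVneq A set0.
    by exists (exist _ p (conj Pp (lexx p))) => q; rewrite A0.
  have [|||m Pm mA] := chain_lb (sval @` A).
  + by move=> _ [q _ <-]; exact: (svalP q).1.
  + exact: image_nonempty.
  + by move=> _ _ [q Aq <-] [r Ar <-]; have [|] := Atot q r Aq Ar; [right|left].
  have mp : (m <= p)%O.
    have [q Aq] := A0; apply: le_trans (svalP q).2.
    by apply: mA; exists q.
  by exists (exist _ m (conj Pm mp)) => q Aq; apply: mA; exists q.
- exists q; split=> // r Pr rq.
  by have /(congr1 sval) := qmin (exist _ r (conj Pr (le_trans rq qp))) rq.
Qed.

Section Sublinear.
Variables (R : realType) (V : lmodType R).
Implicit Types (p q r f g h : V -> R) (x y : V) (A : set (V -> R)).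

Definition sublinear p : Prop :=
  (forall x y, p (x + y) <= p x + p y) /\
  (forall (t : R) x, 0 < t -> p (t *: x) <= t * p x).

Lemma sublinear0 p : sublinear p -> p 0 = 0.
Proof.
move=> [_ pZ]; have := pZ 2 0; have := pZ 2^-1 0.
by rewrite !scaler0 invr_gt0 ltr0n => /(_ isT) ? /(_ isT) ?; lra.
Qed.

Lemma sublinear_geN p x : sublinear p -> - p (- x) <= p x.
Proof.
by move=> sp; have := sp.1 x (- x); rewrite subrr (sublinear0 sp) => ?; lra.
Qed.

Lemma sublinearZ p (t : R) x : sublinear p -> 0 <= t -> p (t *: x) = t * p x.
Proof.
move=> sp; rewrite le0r => /predU1P[->|t0].
  by rewrite scale0r mul0r sublinear0.
apply/eqP; rewrite eq_le sp.2//=.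
have := sp.2 t^-1 (t *: x); rewrite invr_gt0 t0 => /(_ isT).
by rewrite scalerA mulVf ?gt_eqF// scale1r mulrC ler_pdivlMr// mulrC.
Qed.

Definition pointwise_inf A x : R := inf [set f x | f in A].

Lemma pointwise_inf_le A f x : has_lbound [set g x | g in A] -> A f ->
  pointwise_inf A x <= f x.
Proof. by move=> lbA Af; apply: ge_inf => //; exists f. Qed.

Lemma le_pointwise_inf A x (l : R) : A !=set0 -> (forall f, A f -> l <= f x) ->
  l <= pointwise_inf A x.
Proof.
move=> A0 lA; apply: lb_le_inf; first exact: image_nonempty.
by move=> _ [f Af <-]; exact: lA.
Qed.

Lemma sublinear_pointwise_inf A : A !=set0 ->
    (forall x, has_lbound [set f x | f in A]) ->
    (forall f g, A f -> A g ->
      exists2 h, A h & forall x y, h (x + y) <= f x + g y) ->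
    (forall f (t : R), 0 < t -> A f ->
      exists2 h, A h & forall x, h (t *: x) <= t * f x) ->
  sublinear (pointwise_inf A).
Proof.
move=> A0 lbA AD AZ; split=> [x y|t x t0].
- rewrite -lerBlDr; apply: le_pointwise_inf => // f Af.
  rewrite lerBlDr -lerBlDl; apply: le_pointwise_inf => // g Ag.
  rewrite lerBlDl; have [h Ah hfg] := AD f g Af Ag.
  exact: le_trans (pointwise_inf_le (lbA _) Ah) (hfg x y).
- rewrite mulrC -ler_pdivrMr//; apply: le_pointwise_inf => // f Af.
  rewrite ler_pdivrMr// mulrC; have [h Ah hf] := AZ f t t0 Af.
  exact: le_trans (pointwise_inf_le (lbA _) Ah) (hf x).
Qed.

Lemma sublinear_chain_lower_bound A : A `<=` sublinear -> A !=set0 ->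
    total_on A <=%O ->
  exists2 m, sublinear m & forall q, A q -> (m <= q)%O.
Proof.
move=> subA [p Ap] Atot.
have lbA x : has_lbound [set q x | q in A].
  exists (- p (- x)) => _ [q Aq <-].
  have [/lefP pq|/lefP qp] := Atot _ _ Ap Aq.
    exact: le_trans (sublinear_geN x (subA _ Ap)) (pq x).
  by apply: le_trans (sublinear_geN x (subA _ Aq)); rewrite lerN2.
exists (pointwise_inf A); last first.
  by move=> q Aq; apply/lefP => x; exact: pointwise_inf_le.
apply: sublinear_pointwise_inf => //; first by exists p.
- move=> f g Af Ag.
  have [/lefP fg|/lefP gf] := Atot _ _ Af Ag; [exists f|exists g] => // x y.
    by apply: le_trans ((subA f Af).1 x y) _; rewrite lerD2l.
  by apply: le_trans ((subA g Ag).1 x y) _; rewrite lerD2r.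
- by move=> f t t0 Af; exists f => // x; exact: (subA f Af).2.
Qed.

Definition minimal_sublinear q : Prop :=
  sublinear q /\ forall r, sublinear r -> (r <= q)%O -> r = q.

Lemma exists_minimal_sublinear p : sublinear p ->
  exists2 q, minimal_sublinear q & (q <= p)%O.
Proof.
move=> /Zorn_minimal_below/(_ sublinear_chain_lower_bound)[q [sq qp qmin]].
by exists q.
Qed.

Definition translates_along q y : set (V -> R) :=
  [set f | exists2 t : R, 0 <= t & f = fun x => q (x + t *: y) - t * q y].

(* The largest sublinear minorant of q whose value at -y is at most -q y. *)
Definition flatten_along q y : V -> R := pointwise_inf (translates_along q y).

Lemma translates_along_has_lbound q y x : sublinear q ->
  has_lbound [set f x | f in translates_along q y].
Proof.
move=> sq; exists (- q (- x)) => _ [_ [t t0 ->] <-].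
have := sq.1 (x + t *: y) (- x).
by rewrite addrAC subrr add0r (sublinearZ _ sq)// => ?; lra.
Qed.

Lemma flatten_along_le q y x (t : R) : sublinear q -> 0 <= t ->
  flatten_along q y x <= q (x + t *: y) - t * q y.
Proof.
move=> sq t0; pose f x := q (x + t *: y) - t * q y.
apply: (@pointwise_inf_le _ f); first exact: translates_along_has_lbound.
by exists t.
Qed.

Lemma flatten_along_le_id q y : sublinear q -> (flatten_along q y <= q)%O.
Proof.
move=> sq; apply/lefP => x.
by have := flatten_along_le y x sq (lexx 0); rewrite scale0r addr0 mul0r subr0.
Qed.

Lemma flatten_along_le_translate q y x : sublinear q ->
  flatten_along q y x <= q (x + y) - q y.
Proof.
by move=> sq; have := flatten_along_le y x sq ler01; rewrite scale1r mul1r.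
Qed.

Lemma sublinear_flatten_along q y : sublinear q ->
  sublinear (flatten_along q y).
Proof.
move=> sq; apply: sublinear_pointwise_inf.
- by eexists; exists 0.
- by move=> x; exact: translates_along_has_lbound.
- move=> _ _ [s s0 ->] [t t0 ->]; eexists.
    by exists (s + t) => //; rewrite addr_ge0.
  move=> x z /=; have := sq.1 (x + s *: y) (z + t *: y).
  by rewrite addrACA -scalerDl => ?; lra.
- move=> _ t t0 [s s0 ->]; eexists.
    by exists (t * s) => //; rewrite mulr_ge0// ltW.
  move=> x /=; have := sq.2 t (x + s *: y) t0.
  by rewrite scalerDr scalerA => ?; lra.
Qed.

Lemma minimal_sublinear_scalar q : minimal_sublinear q -> scalar q.
Proof.
move=> [sq qmin].
(* Flattening q along y does not change it, so q x <= q (x + y) - q y. *)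
have qD x y : q (x + y) = q x + q y.
  apply/eqP; rewrite eq_le sq.1/=.
  have := flatten_along_le_translate y x sq.
  rewrite (qmin _ (sublinear_flatten_along y sq) (flatten_along_le_id y sq)).
  by move=> ?; lra.
have qN x : q (- x) = - q x.
  by have := qD x (- x); rewrite subrr (sublinear0 sq) => ?; lra.
move=> a x y; rewrite qD; congr (_ + _).
have [a0|a0] := leP 0 a; first by rewrite sublinearZ.
by rewrite -[a]opprK scaleNr qN sublinearZ// ?mulNr// oppr_ge0 ltW.
Qed.

Theorem hahn_banach p e : sublinear p ->
  exists f : V -> R, [/\ scalar f, forall x, f x <= p x & f e = p e].
Proof.
move=> sp; have /lefP pep := flatten_along_le_id e sp.
have [f fmin /lefP fpe] :=
  exists_minimal_sublinear (sublinear_flatten_along e sp).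
have fp x : f x <= p x by exact: le_trans (fpe x) (pep x).
have fl := minimal_sublinear_scalar fmin.
exists f; split=> //; apply/eqP; rewrite eq_le fp/=.
have := flatten_along_le_translate e (- e) sp; have := fpe (- e).
rewrite addNr (sublinear0 sp) -scaleN1r (scalable_linear fl) /=.
by move=> ? ?; lra.
Qed.

End Sublinear.

Section LinearCombinations.
Variables (K : pzRingType) (V : lmodType K).

Definition lincomb n (e : 'I_n -> V) (c : 'cV[K]_n) : V := \sum_i c i 0 *: e i.

Lemma lincomb_is_linear n (e : 'I_n -> V) : linear (lincomb e).
Proof.
move=> a c d; rewrite /lincomb scaler_sumr -big_split/=; apply: eq_bigr => i _.
by rewrite !mxE scalerDl scalerA.
Qed.

HB.instance Definition _ n (e : 'I_n -> V) :=
  GRing.isLinear.Build K 'cV[K]_n V *:%R (lincomb e) (lincomb_is_linear e).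

Lemma lincomb_delta n (e : 'I_n -> V) i : lincomb e (delta_mx i 0) = e i.
Proof.
rewrite /lincomb (bigD1 i)//= mxE !eqxx scale1r big1 ?addr0// => j /negPf ji.
by rewrite mxE ji scale0r.
Qed.

End LinearCombinations.

Lemma linear_fun0 (K : pzRingType) (V W : lmodType K) (f : V -> W) :
  linear f -> f 0 = 0.
Proof. by move=> lf; rewrite -[0]subr0 (zmod_morphism_linear lf) subrr. Qed.

Lemma linear_lincomb (K : pzRingType) (V W : lmodType K) (f : V -> W) n
    (e : 'I_n -> V) (c : 'cV[K]_n) : linear f ->
  f (lincomb e c) = lincomb (f \o e) c.
Proof.
move=> lf.
pose g : {linear V -> W} := HB.pack f (GRing.isLinear.Build _ _ _ _ f lf).
rewrite -[f]/(g : _ -> _) linear_sum; apply: eq_bigr => i _; exact: linearZZ.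
Qed.

Lemma lincomb_mulmx (K : comPzRingType) (V : lmodType K) n m (e : 'I_n -> V)
    (A : 'M[K]_(n, m)) (c : 'cV[K]_m) :
  lincomb e (A *m c) = lincomb (fun j => lincomb e (col j A)) c.
Proof.
rewrite /lincomb; under eq_bigr do rewrite mxE scaler_suml.
rewrite exchange_big; apply: eq_bigr => j _; rewrite scaler_sumr.
by apply: eq_bigr => i _; rewrite mxE scalerA mulrC.
Qed.

Section Evaluation.
Variables (K : fieldType) (V : lmodType K) (n m : nat).
Implicit Types (psi : 'I_n -> V -> K^o) (e : 'I_m -> V).

Definition eval_col psi (v : V) : 'cV[K]_n := \col_i psi i v.

Definition eval_mx psi e : 'M[K]_(n, m) := \matrix_(i, j) psi i (e j).

Lemma eval_col_lincomb psi e c : (forall i, linear (psi i)) ->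
  eval_col psi (lincomb e c) = eval_mx psi e *m c.
Proof.
move=> lpsi; apply/colP => i; rewrite !mxE (linear_lincomb _ _ (lpsi i)).
by apply: eq_bigr => j _; rewrite mxE mulrC.
Qed.

Lemma linear_eval_col psi : (forall i, linear (psi i)) ->
  linear (eval_col psi).
Proof. by move=> lpsi a u v; apply/colP => i; rewrite !mxE lpsi. Qed.

End Evaluation.

Section SeparatingRows.
Variables (K : fieldType) (n : nat) (W : set 'rV[K]_n).
Hypothesis W_separating :
  forall c : 'cV[K]_n, (forall w, W w -> w *m c = 0) -> c = 0.

Lemma row_free_of_separating k : (k <= n)%N ->
  exists2 A : 'M[K]_(k, n), row_free A & forall i, W (row i A).
Proof.
elim: k => [|k IH] kn.
  by exists 0 => [|[]//]; rewrite /row_free mxrank0.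
have [A freeA WA] := IH (ltnW kn).
have [w Ww wA] : exists2 w, W w & ~~ (w <= A)%MS.
  apply: contrapT => /forall2NP WsubA; suff : row_full A.
    by rewrite /row_full (eqP freeA) (ltn_eqF kn).
  rewrite -cokermx_eq0; apply/eqP/matrixP => i j.
  suff /colP/(_ i) : col j (cokermx A) = 0 by rewrite !mxE.
  apply: W_separating => w Ww; rewrite colE mulmxA.
  have [//|/negP/negbNE] := WsubA w.
  by rewrite submxE => /eqP ->; rewrite mul0mx.
rewrite -addn1; exists (col_mx A w).
  have /rank_ltmx : (A < col_mx A w)%MS.
    by rewrite ltmxE -addsmxE addsmxSl col_mx_sub submx_refl.
  rewrite (eqP freeA) => rkA.
  by rewrite /row_free eqn_leq rank_leq_row [X in (X <= _)%N]addn1.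
move=> i; case: (split_ordP i) => j ->.
  by rewrite rowKu.
by rewrite rowKd row_id.
Qed.

Lemma unitmx_of_separating :
  exists2 A : 'M[K]_n, A \in unitmx & forall i, W (row i A).
Proof.
have [A freeA WA] := row_free_of_separating (leqnn n).
by exists A; rewrite // -row_free_unit.
Qed.

End SeparatingRows.

Lemma unitmx_eval_of_separating (K : fieldType) (V : lmodType K)
    (Phi : set (V -> K^o)) n (e : 'I_n -> V) :
    (forall phi, Phi phi -> linear phi) ->
    (forall v, v != 0 -> exists2 phi, Phi phi & phi v != 0) ->
    (forall c, lincomb e c = 0 -> c = 0) ->
  exists2 psi : 'I_n -> V -> K^o, forall i, Phi (psi i) &
    eval_mx psi e \in unitmx.
Proof.
move=> linPhi sepPhi freee.
pose W := [set \row_j phi (e j) | phi in Phi].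
have [c Wc|A uA WA] := @unitmx_of_separating _ _ W.
  apply: freee; apply/eqP/negPn/negP => /sepPhi[phi Phiphi /eqP]; apply.
  rewrite (linear_lincomb _ _ (linPhi _ Phiphi)).
  have /rowP/(_ 0) := Wc _ (imageP _ Phiphi); rewrite !mxE => <-.
  by apply: eq_bigr => j _; rewrite mxE mulrC.
have /choice[psi /all_and2[Phipsi psiA]] i :
    exists phi, Phi phi /\ \row_j phi (e j) = row i A.
  by have [phi] := WA i; exists phi.
exists psi => //; suff -> : eval_mx psi e = A by [].
by apply/matrixP => i j; have /rowP/(_ j) := psiA i; rewrite !mxE.
Qed.

Section CompressedInverse.
Variables (K : fieldType) (E F : lmodType K) (n : nat).
Variables (x : 'I_n -> E) (psi : 'I_n -> F -> K^o).
Implicit Types A B : E -> F.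

Definition compression A : 'M[K]_n := eval_mx psi (A \o x).

Definition compressed_inverse A (y : F) : E :=
  lincomb x (invmx (compression A) *m eval_col psi y).

Hypothesis psi_linear : forall i, linear (psi i).

Lemma linear_compressed_inverse A : linear (compressed_inverse A).
Proof.
move=> a y z; rewrite /compressed_inverse linear_eval_col// mulmxDr -scalemxAr.
exact: linearP.
Qed.

Lemma eval_col_compression A c : linear A ->
  eval_col psi (A (lincomb x c)) = compression A *m c.
Proof. by move=> lA; rewrite linear_lincomb// eval_col_lincomb. Qed.

Lemma compression_unitmx_inj A c : linear A -> compression A \in unitmx ->
  A (lincomb x c) = 0 -> c = 0.
Proof.
move=> lA uA Ac0; rewrite -[c](mulKmx uA) -eval_col_compression// Ac0.
by rewrite (linear_fun0 (linear_eval_col psi_linear)) mulmx0.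
Qed.

Lemma compressed_inverseK A c : linear A -> compression A \in unitmx ->
  compressed_inverse A (A (lincomb x c)) = lincomb x c.
Proof.
by move=> lA uA; rewrite /compressed_inverse eval_col_compression// mulKmx.
Qed.

Lemma compressed_inverse_outer A : linear A -> compression A \in unitmx ->
  compressed_inverse A \o A \o compressed_inverse A = compressed_inverse A.
Proof. by move=> lA uA; apply/funext => y; exact: compressed_inverseK. Qed.

Lemma compressed_inverse_inner A : linear A -> compression A \in unitmx ->
    range A `<=` range (A \o lincomb x) ->
  A \o compressed_inverse A \o A = A.
Proof.
move=> lA uA rangeA; apply/funext => u /=.
have [c _ <-] : range (A \o lincomb x) (A u) by apply: rangeA; exists u.
by rewrite /= compressed_inverseK.
Qed.

Lemma compressed_inverse_sub A B y : linear A -> linear B ->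
    compression A \in unitmx -> compression B \in unitmx ->
  compressed_inverse A y - compressed_inverse B y =
  compressed_inverse A
    (B (compressed_inverse B y) - A (compressed_inverse B y)).
Proof.
move=> lA lB uA uB.
rewrite (zmod_morphism_linear (linear_compressed_inverse A)).
rewrite compressed_inverseK//; congr (_ - _).
by rewrite /compressed_inverse eval_col_compression// mulKVmx.
Qed.

End CompressedInverse.

Lemma resolvent_expansion (K : comPzRingType) (X Y : lmodType K) (S : X -> Y)
    (Gl Gm : Y -> X) (l m : K) n y : linear S -> linear Gm ->
    (forall z, Gm z - Gl z = (m - l) *: Gm (S (Gl z))) ->
  Gl y - \sum_(k < n) (l - m) ^+ k *: iter k (Gm \o S) (Gm y)
  = (l - m) ^+ n *: iter n (Gm \o S) (Gl y).
Proof.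
move=> lS lG Gsub; have lGSn k : linear (iter k (Gm \o S)).
  by elim: k => [|k IH] a u v //; rewrite !iterS IH /= lS lG.
elim: n => [|n IH]; first by rewrite big_ord0 subr0 expr0 scale1r.
rewrite big_ord_recr/= opprD addrA IH -scalerBr.
rewrite -(zmod_morphism_linear (lGSn n)).
have -> : Gl y - Gm y = (l - m) *: (Gm \o S) (Gl y).
  by rewrite -opprB Gsub -scaleNr opprB.
by rewrite (scalable_linear (lGSn n)) scalerA -exprSr -iterSr.
Qed.

Section BoundedOperators.
Variable R : realType.
Implicit Types E F H : normedModType R[i].

Lemma Re_normK E (x : E) : (complex.Re `|x|)%:C = `|x|.
Proof. exact: RRe_real (normr_real x). Qed.

Lemma Re_norm_ge0 E (x : E) : 0 <= complex.Re `|x|.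
Proof. by rewrite -ler0c Re_normK. Qed.

Lemma bounded_operatorP E F (f : E -> F) : bounded_operator f ->
  exists2 M : R, 0 <= M & forall x, `|f x| <= M%:C * `|x|.
Proof.
move=> [_ [M fM]]; exists `|M| => // x; apply: le_trans (fM x) _.
by rewrite ler_wpM2r// lecR ler_norm.
Qed.

Lemma bounded_operator_comp E F H (g : F -> H) (f : E -> F) :
  bounded_operator g -> bounded_operator f -> bounded_operator (g \o f).
Proof.
move=> bg bf; split; first by move=> a x y /=; rewrite bf.1 bg.1.
have [M M0 gM] := bounded_operatorP bg; have [N N0 fN] := bounded_operatorP bf.
exists (M * N) => x; apply: le_trans (gM _) _.
by rewrite rmorphM/= -mulrA ler_wpM2l// ler0c.
Qed.

Lemma bounded_operator_iter E (f : E -> E) k :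
  bounded_operator f -> bounded_operator (iter k f).
Proof.
move=> bf; elim: k => [|k IH]; last exact: (bounded_operator_comp bf IH).
by split=> //; exists 1 => x; rewrite mul1r.
Qed.

Lemma bounded_operator_sum E F n (f : 'I_n -> E -> F) :
  (forall i, bounded_operator (f i)) ->
  bounded_operator (fun x => \sum_i f i x).
Proof.
move=> bf; split=> [a x y|].
  rewrite scaler_sumr -big_split; apply: eq_bigr => i _; exact: (bf i).1.
have /choice[M fM] i := (bf i).2.
exists (\sum_i M i) => x; apply: le_trans (ler_norm_sum _ _ _) _.
by rewrite rmorph_sum mulr_suml; apply: ler_sum.
Qed.

Lemma bounded_operator_scaler E F (psi : E -> R[i]^o) (v : F) :
  bounded_operator psi -> bounded_operator (fun x => psi x *: v).
Proof.
move=> bpsi; split; first by move=> a x y; rewrite bpsi.1 scalerDl scalerA.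
have [M M0 psiM] := bounded_operatorP bpsi.
exists (M * complex.Re `|v|) => x.
by rewrite rmorphM/= Re_normK normrZ mulrAC ler_wpM2r.
Qed.

Lemma norm_iter_le E (f : E -> E) (M : R) k x : 0 <= M ->
  (forall y, `|f y| <= M%:C * `|y|) -> `|iter k f x| <= (M ^+ k)%:C * `|x|.
Proof.
move=> M0 fM; elim: k => [|k IH]; first by rewrite mul1r.
rewrite iterS exprS rmorphM/= -mulrA; apply: le_trans (fM _) _.
by rewrite ler_wpM2l// ler0c.
Qed.

Lemma opnorm_ge0 E F (f : E -> F) : 0 <= opnorm f.
Proof.
rewrite /opnorm; set A := [set _ | _ in _].
have [supA|/sup_out -> //] := pselect (has_sup A).
apply: le_trans (Re_norm_ge0 (f 0)) _.
by apply: (ub_le_sup supA.2); exists 0; rewrite //= normr0.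
Qed.

Lemma opnorm_le E F (f : E -> F) (M : R) : 0 <= M ->
  (forall x, `|f x| <= M%:C * `|x|) -> opnorm f <= M.
Proof.
move=> M0 fM; apply: ge_sup.
  by exists (complex.Re `|f 0|), 0; rewrite //= normr0.
move=> _ [x /= x1 <-]; rewrite -lecR Re_normK.
by apply: le_trans (fM x) _; rewrite ler_piMr// ler0c.
Qed.

End BoundedOperators.

Section Realification.
Variables (R : realType) (V : lmodType R[i]).

Definition realification : Type := V.

HB.instance Definition _ := GRing.Zmodule.on realification.

Let scale (a : R) (v : realification) : realification := a%:C *: (v : V).

Let scaleA a b v : scale a (scale b v) = scale (a * b) v.
Proof. by rewrite /scale scalerA rmorphM. Qed.

Let scale1 : left_id 1 scale.
Proof. by move=> v; rewrite /scale rmorph1 scale1r. Qed.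

Let scaleDr : right_distributive scale +%R.
Proof. by move=> a u v; rewrite /scale scalerDr. Qed.

Let scaleDl v : {morph scale^~ v : a b / a + b}.
Proof. by move=> a b; rewrite /scale rmorphD scalerDl. Qed.

HB.instance Definition _ := GRing.Zmodule_isLmodule.Build R realification
  scaleA scale1 scaleDr scaleDl.

Lemma realification_scaleE (a : R) (v : realification) :
  a *: v = a%:C *: (v : V) :> V.
Proof. by []. Qed.

End Realification.

Section Complexification.
Variables (R : realType) (V : lmodType R[i]).
Variable f : realification V -> R.
Hypothesis f_scalar : scalar f.

Definition complexification (v : V) : R[i]^o := f v +i* - f ('i *: v).

Lemma linear_complexification : linear complexification.
Proof.
have fD (u v : V) : f (u + v) = f u + f v.
  by have := f_scalar 1 u v; rewrite scale1r mul1r.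
have fZ (a : R) (v : V) : f (a%:C *: v) = a * f v.
  exact: (scalable_linear f_scalar).
have ReImE a (v : V) :
    a *: v = (complex.Re a)%:C *: v + (complex.Im a)%:C *: ('i *: v).
  by rewrite scalerA -scalerDl [in LHS](complexE a) (mulrC 'i).
have iiN (v : V) : 'i *: ('i *: v) = (-1)%:C *: v.
  by rewrite scalerA -expr2 sqr_i rmorphN1.
have iC a (v : V) : 'i *: (a%:C *: v) = a%:C *: ('i *: v).
  by rewrite !scalerA mulrC.
move=> a u v; rewrite /complexification (ReImE a) !scalerDr !iC iiN !fD !fZ.
by case: a => a b; rewrite /GRing.scale/=; simpc; congr (_ +i* _); lra.
Qed.

End Complexification.

Section ContinuousDual.
Variables (R : realType) (V : normedModType R[i]).

Lemma sublinear_norm :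
  sublinear (fun v : realification V => complex.Re `|v : V|).
Proof.
split=> [x y|t x t0].
  by rewrite -raddfD; have := ler_normD (x : V) y; rewrite lecE => /andP[].
rewrite realification_scaleE normrZ ger0_norm; last by rewrite ler0c ltW.
by rewrite -[X in _ * X]Re_normK -rmorphM.
Qed.

(* Rotating v by the conjugate phase of its image makes that image real. *)
Lemma complexification_norm_le (f : realification V -> R) : scalar f ->
  (forall v, f v <= complex.Re `|v : V|) ->
  forall v, `|complexification f v| <= `|v|.
Proof.
move=> lf fle v; set phi := complexification f.
have lphi : linear phi := linear_complexification lf.
have [->|phi0] := eqVneq (phi v) 0; first by rewrite normr0.
pose w := (`|phi v| / phi v) *: v.
have phiw : phi w = `|phi v|.
  by rewrite /w (scalable_linear lphi); exact: divfK.
have -> : `|v| = `|w|.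
  by rewrite normrZ normrM normfV !normr_id divff ?normr_eq0// mul1r.
rewrite -(Re_normK (phi v)) -(Re_normK w) lecR -phiw.
exact: fle.
Qed.

Lemma bounded_functional_neq0 (v : V) : v != 0 ->
  exists2 phi : V -> R[i]^o, bounded_operator phi & phi v != 0.
Proof.
move=> v0.
have [f [lf fle fv]] := hahn_banach (v : realification V) sublinear_norm.
exists (complexification f).
  split; first exact: linear_complexification.
  by exists 1 => x; rewrite mul1r; exact: complexification_norm_le.
apply: contra_neq v0 => /(congr1 (@complex.Re R)) /=; rewrite fv => v0.
by apply/normr0_eq0; rewrite -(Re_normK v) v0.
Qed.

End ContinuousDual.

Section Dimension.
Variable R : realType.
Implicit Types E F : normedModType R[i].

Lemma lin_indepP F n (e : 'I_n -> F) :
  lin_indep e <-> forall c, lincomb e c = 0 -> c = 0.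
Proof.
split=> [ie c c0|ie c c0 i].
  by apply/colP => i; rewrite mxE; exact: (ie (c^~ 0)).
suff /ie/colP/(_ i) : lincomb e (\col_j c j) = 0 by rewrite !mxE.
by rewrite -[RHS]c0; apply: eq_bigr => j _; rewrite mxE.
Qed.

Lemma lin_spanE F n (e : 'I_n -> F) : lin_span e = range (lincomb e).
Proof.
apply/seteqP; split=> v [c]; last by move=> _ <-; exists (c^~ 0).
move=> ->; exists (\col_i c i) => //.
by apply: eq_bigr => i _; rewrite mxE.
Qed.

Lemma lin_span_mem F n (e : 'I_n -> F) i : lin_span e (e i).
Proof. by rewrite lin_spanE; exists (delta_mx i 0); rewrite ?lincomb_delta. Qed.

Lemma dimension_Some F (V : set F) n : dimension V = Some n -> has_dim V n.
Proof. by rewrite /dimension; case: xgetP => // _ _ [m Vm <-] [<-]. Qed.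

Lemma has_dim_eq_lin_span F (V : set F) n (w : 'I_n -> F) :
  has_dim V n -> lin_indep w -> (forall i, V (w i)) -> V = lin_span w.
Proof.
move=> [e [_ ->]] /lin_indepP iw /choice[a wa].
rewrite !lin_spanE; pose A := \matrix_(i, j) a j i.
have lincombw c : lincomb w c = lincomb e (A *m c).
  rewrite lincomb_mulmx; congr lincomb; apply/funext => j.
  by rewrite wa; apply: eq_bigr => i _; rewrite !mxE.
have uA : A \in unitmx.
  rewrite -unitmx_tr -row_free_unit; apply: inj_row_free => v vA.
  apply/trmx_inj; rewrite trmx0; apply: iw.
  by rewrite lincombw -[A]trmxK -trmx_mul vA trmx0 linear0.
apply/seteqP; split=> _ [c _ <-]; last by exists (A *m c).
by exists (invmx A *m c); rewrite // lincombw mulKVmx.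
Qed.

Lemma has_dim_image E F (f : E -> F) (V : set E) n : linear f ->
    (forall v, V v -> f v = 0 -> v = 0) ->
  has_dim V n -> has_dim (f @` V) n.
Proof.
move=> lf f_inj [e [/lin_indepP ie Ve]]; exists (f \o e); split.
  apply/lin_indepP => c; rewrite -linear_lincomb// => fc0; apply: ie.
  by apply: f_inj fc0; rewrite Ve lin_spanE; exists c.
rewrite Ve !lin_spanE image_comp.
by apply: eq_imagel => c _; exact: linear_lincomb.
Qed.

End Dimension.

Section GeneralizedInverse.
Variable R : realType.
Implicit Types E F : normedModType R[i].

Definition generalized_inverse E F (A : E -> F) (G : F -> E) : Prop :=
  A \o G \o A = A /\ G \o A \o G = G.

Lemma generalized_inverse_sym E F (A : E -> F) (G : F -> E) :
  generalized_inverse A G -> generalized_inverse G A.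
Proof. by case. Qed.

Lemma range_generalized_inverse E F (A : E -> F) (G : F -> E) :
  generalized_inverse A G -> range G = G @` range A.
Proof.
move=> [_ GAG]; apply/seteqP; split=> _ [y _ <-].
  by exists (A (G y)); [exists (G y)|rewrite -[RHS](congr1 (@^~ y) GAG)].
by exists y.
Qed.

Lemma has_dim_generalized_inverse E F (A : E -> F) (G : F -> E) n :
    linear A -> linear G -> generalized_inverse A G ->
  has_dim (range A) n -> has_dim (range G) n.
Proof.
move=> lA lG AG; rewrite (range_generalized_inverse AG).
apply: has_dim_image => // _ [x _ <-] GAx0.
by rewrite -[A x](congr1 (@^~ x) AG.1) /= GAx0 linear_fun0.
Qed.

Lemma Rank_generalized_inverse E F (A : E -> F) (G : F -> E) :
  linear A -> linear G -> generalized_inverse A G -> Rank A = Rank G.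
Proof.
move=> lA lG AG; rewrite /Rank /dimension; congr (xget _ (image _ _)).
apply/seteqP; split=> n; apply: has_dim_generalized_inverse => //.
exact: generalized_inverse_sym.
Qed.

End GeneralizedInverse.

Section FiniteRankInverse.
Variables (R : realType) (E F : normedModType R[i]) (n : nat).

Lemma exists_compression_unitmx (A : E -> F) :
    linear A -> has_dim (range A) n ->
  exists x psi, (forall i, bounded_operator (psi i)) /\
    @compression R[i] E F n x psi A \in unitmx.
Proof.
move=> lA [e [/lin_indepP ie rA]].
have /choice[x xe] i : exists x, A x = e i.
  have [x _ xe] : range A (e i) by rewrite rA; exact: lin_span_mem.
  by exists x.
have [psi bpsi unitpsi] := unitmx_eval_of_separating (fun _ => @proj1 _ _)
  (@bounded_functional_neq0 R F) ie.
exists x, psi; split=> //; rewrite /compression.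
by have -> : A \o x = e by apply/funext.
Qed.

Variables (x : 'I_n -> E) (psi : 'I_n -> F -> R[i]^o).
Hypothesis psi_bounded : forall i, bounded_operator (psi i).
Implicit Types A : E -> F.

Lemma bounded_operator_compressed_inverse A :
  bounded_operator (compressed_inverse x psi A).
Proof.
pose M := invmx (compression x psi A).
have -> : compressed_inverse x psi A =
    fun y => \sum_j \sum_i psi i y *: (M j i *: x j).
  apply/funext => y; apply: eq_bigr => j _; rewrite mxE scaler_suml.
  by apply: eq_bigr => i _; rewrite mxE scalerA mulrC.
apply: bounded_operator_sum => j; apply: bounded_operator_sum => i.
exact: bounded_operator_scaler.
Qed.

Lemma range_compression A :
    linear A -> compression x psi A \in unitmx -> has_dim (range A) n ->
  range A = range (A \o lincomb x).
Proof.
move=> lA uA dimA; have iAx : lin_indep (A \o x).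
  apply/lin_indepP => c; rewrite -linear_lincomb//.
  by apply: compression_unitmx_inj uA => // i; exact: (psi_bounded i).1.
rewrite (has_dim_eq_lin_span dimA iAx) => [|i]; last by exists (x i).
by rewrite lin_spanE; apply: eq_imagel => c _; rewrite /= linear_lincomb.
Qed.

End FiniteRankInverse.

Section Invertibility.
Variables (K : numFieldType) (T : topologicalType) (n : nat).
Variable M : T -> 'M[K^o]_n.
Hypothesis continuous_entries : forall i j, continuous (fun t => M t i j).

Lemma continuous_det : continuous (fun t => \det (M t) : K^o).
Proof.
apply: (@continuous_big K^o _ +%R 0 xpredT) => [|s _ t].
  exact: add_continuous.
apply: (@continuousM K T); first exact: cst_continuous.
apply: (@continuous_big K^o _ *%R 1 xpredT) => [z|i _].
  by apply: cvgM; [exact: cvg_fst|exact: cvg_snd].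
exact: continuous_entries.
Qed.

Lemma open_unitmx : open [set t | M t \in unitmx].
Proof.
have -> : [set t | M t \in unitmx] = (fun t => \det (M t)) @^-1` (~` [set 0]).
  by apply/seteqP; split=> t /=; rewrite unitmxE unitfE => /eqP.
apply: open_comp; first by move=> t _; exact: continuous_det.
rewrite openC; apply: accessible_closed_set1; apply: hausdorff_accessible.
exact: norm_hausdorff.
Qed.

End Invertibility.

Section Pencil.
Variables (R : realType) (X Y : normedModType R[i]) (T S : X -> Y).
Implicit Types (U : set (Cplx R)) (G : Cplx R -> Y -> X).

Lemma pencil0 : pencil T S 0 = T.
Proof. by apply/funext => x; rewrite /pencil scale0r subr0. Qed.

Lemma pencil_sub l m x : pencil T S m x - pencil T S l x = (l - m) *: S x.
Proof. by rewrite /pencil scalerBl opprB addrC subrKA. Qed.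

Hypotheses (T_linear : linear T) (S_linear : linear S).

Lemma linear_pencil l : linear (pencil T S l).
Proof.
move=> a x y; rewrite /pencil T_linear S_linear scalerDr opprD addrACA scalerBr.
by rewrite !scalerA mulrC.
Qed.

Lemma range_generalized_resolvent U G l m :
  generalized_resolvent T S U G -> U l -> U m -> range (G l) = range (G m).
Proof.
move=> [bG _ _ Gsub].
suff sub j k : U j -> U k -> range (G j) `<=` range (G k).
  by move=> Ul Um; apply/seteqP; split; exact: sub.
move=> Uj Uk _ [y _ <-]; exists (y - (k - j) *: S (G j y)) => //.
have lGk := (bG k Uk).1.
rewrite (zmod_morphism_linear lGk) (scalable_linear lGk).
by rewrite -[X in _ - X](congr1 (@^~ y) (Gsub _ _ Uk Uj)) opprB addrC subrK.
Qed.

Lemma Rank_generalized_resolvent U G l m :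
    generalized_resolvent T S U G -> U l -> U m ->
  Rank (pencil T S l) = Rank (pencil T S m).
Proof.
move=> resG Ul Um; have [bG PGP GPG _] := resG.
have RankG k : U k -> Rank (pencil T S k) = Rank (G k).
  move=> Uk; apply: Rank_generalized_inverse (linear_pencil k) (bG k Uk).1 _.
  by split; [exact: PGP|exact: GPG].
by rewrite !RankG// /Rank (range_generalized_resolvent resG Ul Um).
Qed.

Section CompressedResolvent.
Variables (n : nat) (x : 'I_n -> X) (psi : 'I_n -> Y -> R[i]^o).
Hypothesis psi_bounded : forall i, bounded_operator (psi i).

Lemma open_compression_pencil :
  open [set l : Cplx R | compression x psi (pencil T S l) \in unitmx].
Proof.
apply: open_unitmx => i j.
have -> : (fun l => compression x psi (pencil T S l) i j) =
    cst (psi i (T (x j))) - ( *:%R^~ (psi i (S (x j))) : Cplx R -> Cplx R).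
  apply/funext => l; have lpsi := (psi_bounded i).1.
  by rewrite mxE /= (zmod_morphism_linear lpsi) (scalable_linear lpsi).
move=> l; apply: (@continuousB _ (Cplx R) (Cplx R)).
  exact: cst_continuous.
exact: scalel_continuous.
Qed.

Lemma generalized_resolvent_compressed_inverse U :
    (forall l, U l -> compression x psi (pencil T S l) \in unitmx) ->
    (forall l, U l -> has_dim (range (pencil T S l)) n) ->
  generalized_resolvent T S U
    (fun l => compressed_inverse x psi (pencil T S l)).
Proof.
move=> unitU dimU; have lP := linear_pencil.
have lpsi i : linear (psi i) := (psi_bounded i).1.
split=> [l _|l Ul|l Ul|l m Ul Um].
- exact: bounded_operator_compressed_inverse.
- apply: compressed_inverse_inner (unitU l Ul) _ => //.
  by rewrite -(range_compression psi_bounded (lP l) (unitU l Ul) (dimU l Ul)).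
- exact: compressed_inverse_outer (unitU l Ul).
- apply/funext => y.
  rewrite compressed_inverse_sub//; [|exact: unitU|exact: unitU].
  rewrite pencil_sub.
  have [lG _] :=
    bounded_operator_compressed_inverse x psi_bounded (pencil T S l).
  exact: (scalable_linear lG).
Qed.

End CompressedResolvent.

End Pencil.

Section Analyticity.
Variables (R : realType) (X Y : normedModType R[i]) (T S : X -> Y).
Variables (U : set (Cplx R)) (G : Cplx R -> Y -> X).
Hypothesis S_bounded : bounded_operator S.
Hypothesis G_resolvent : generalized_resolvent T S U G.

Lemma opnorm_resolvent_remainder_le l m (K : R) : U l -> U m -> 0 <= K ->
    (forall x, `|G m (S x)| <= K%:C * `|x|) ->
  exists2 M : R, 0 <= M & forall n,
    opnorm (fun y => G l y -
      \sum_(k < n) (l - m) ^+ k *: iter k (G m \o S) (G m y))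
    <= M * (complex.Re `|l - m| * K) ^+ n.
Proof.
move=> Ul Um K0 GSK; have [bG _ _ Gsub] := G_resolvent.
have [M M0 GM] := bounded_operatorP (bG _ Ul); exists M => // n.
set d := complex.Re _; have d0 : 0 <= d by exact: Re_norm_ge0.
apply: opnorm_le => [|y]; first by rewrite mulr_ge0// exprn_ge0// mulr_ge0.
rewrite (resolvent_expansion _ _ S_bounded.1 (bG _ Um).1) => [|z]; last first.
  exact: (congr1 (@^~ z) (Gsub _ _ Um Ul)).
apply: le_trans (_ : (d ^+ n)%:C * ((K ^+ n)%:C * (M%:C * `|y|)) <= _).
  rewrite normrZ normrX -[`|l - m|]Re_normK -rmorphXn.
  rewrite ler_wpM2l ?ler0c ?exprn_ge0//.
  apply: le_trans (norm_iter_le _ _ K0 GSK) _.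
  by rewrite ler_wpM2l// ler0c exprn_ge0.
by rewrite (mulrC M) exprMn !rmorphM/= !mulrA.
Qed.

Lemma generalized_resolvent_analytic : analytic_on U G.
Proof.
have [bG _ _ _] := G_resolvent; move=> m Um.
have bGS := bounded_operator_comp (bG m Um) S_bounded.
have [K K0 GSK] := bounded_operatorP bGS.
exists (K + 1)^-1, (fun k => iter k (G m \o S) \o G m); split.
- by rewrite invr_gt0 ltr_wpDl.
- move=> k; apply: bounded_operator_comp (bG m Um).
  exact: bounded_operator_iter.
move=> l Ul; rewrite -[X in X < _]Re_normK ltcR => dK.
have [M M0 remainder_le] := opnorm_resolvent_remainder_le Ul Um K0 GSK.
have d0 := Re_norm_ge0 (l - m).
have dK1 : `|complex.Re `|l - m| * K| < 1.
  rewrite ger0_norm ?mulr_ge0//.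
  move: dK; rewrite -[_^-1]mul1r ltr_pdivlMr ?ltr_wpDl// => ?; lra.
apply: (squeeze_cvgr _ (@cvg_cst _ 0 _ _ _) (cvg_geometric M dK1)).
by apply: nearW => n; rewrite opnorm_ge0 remainder_le.
Qed.

End Analyticity.

Theorem theorem2p3 (R : realType) (X Y : completeNormedModType R[i])
    (T S : X -> Y) (hT : bounded_operator T) (hS : bounded_operator S)
    (hTfin : finite_rank T) :
  (exists (U : set (Cplx R)) (G : Cplx R -> Y -> X),
     open_neighborhood0 U /\ analytic_generalized_resolvent T S U G)
  <->
  (exists U : set (Cplx R),
     open_neighborhood0 U /\
     forall lambda, U lambda -> Rank (pencil T S lambda) = Rank T).
Proof.
split=> [[U [G [[oU U0] [resG _]]]]|[U [[oU U0] RankU]]].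
  exists U; split=> // l Ul.
  by rewrite (Rank_generalized_resolvent hT.1 hS.1 resG Ul U0) pencil0.
have [n RankT] := hTfin.
have [x [psi [bpsi unitT]]] :=
  exists_compression_unitmx hT.1 (dimension_Some RankT).
pose W := U `&` [set l | compression x psi (pencil T S l) \in unitmx].
pose G l := compressed_inverse x psi (pencil T S l).
have resG : generalized_resolvent T S W G.
  apply: (generalized_resolvent_compressed_inverse hT.1 hS.1 bpsi) => l [Ul //].
  by move=> _; apply: dimension_Some; rewrite -RankT; exact: RankU.
exists W, G; split; last first.
  by split=> //; exact: generalized_resolvent_analytic resG.
split; first by apply: openI => //; exact: open_compression_pencil.
by split=> //=; rewrite pencil0.
Qed.
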